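(* Let $n\ge 1$ be an integer. For real numbers $a_1,\ldots,a_n$ satisfying the normalization condition $\sum_{j=1}^n a_j=1$, consider the pair of conjugate trigonometric polynomials $$C(t)=\sum_{j=1}^{n}a_j\cos jt,\qquad S(t)=\sum_{j=1}^{n}a_j\sin jt .$$ Let $$I=\sup_{\substack{(a_1,\ldots,a_n)\in\mathbb{R}^n\\ \sum_{j=1}^n a_j=1}}\ \min_{t}\left\{\,C(t): t\in\mathbb{R},\ S(t)=0\,\right\}.$$ Then $$I=-\tan^{2}\frac{\pi}{2(n+1)}.$$
   Context: For each admissible coefficient vector, the inner minimum is taken over all real zeros $t$ of $S$; by periodicity and parity it is enough to consider $t\in[0,\pi]$. *)

(* Defs.v *)
(* MathComp-Analysis, over an arbitrary realType. *)
From mathcomp Require Import all_boot all_order all_algebra.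
From mathcomp Require Import all_classical all_reals all_analysis.

Set Implicit Arguments.
Unset Strict Implicit.
Unset Printing Implicit Defensive.

Import Order.TTheory GRing.Theory Num.Theory.
Local Open Scope classical_set_scope.
Local Open Scope ring_scope.

(* The index j : 'I_n is zero-based: [a j] is the coefficient a_{j+1}. *)
Definition cosine_poly (R : realType) (n : nat) (a : 'I_n -> R) (t : R) : R :=
  \sum_(j < n) a j * cos (j.+1%:R * t).

Definition sine_poly (R : realType) (n : nat) (a : 'I_n -> R) (t : R) : R :=
  \sum_(j < n) a j * sin (j.+1%:R * t).

Definition normalized (R : realType) (n : nat) (a : 'I_n -> R) : Prop :=
  \sum_(j < n) a j = 1.

(* {C(t) : t in R, S(t) = 0} *)
Definition zero_values (R : realType) (n : nat) (a : 'I_n -> R) : set R :=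
  [set cosine_poly a t | t in [set t : R | sine_poly a t = 0]].

(* An attained minimum, as opposed to a mere infimum. *)
Definition is_min (R : realType) (A : set R) (m : R) : Prop :=
  A m /\ lbound A m.

(* The set whose supremum is I: the inner minima min {C(t) : S(t) = 0}, over
   all normalized coefficient vectors. *)
Definition minima (R : realType) (n : nat) : set R :=
  [set m : R | exists a : 'I_n -> R, normalized a /\ is_min (zero_values a) m].

(* Main.v *)
Require Import Defs.
From mathcomp Require Import all_boot all_order all_algebra.
From mathcomp Require Import all_classical all_reals all_analysis.
From mathcomp Require Import ring lra zify.

Import Order.TTheory GRing.Theory Num.Theory.
Import numFieldNormedType.Exports.
Local Open Scope classical_set_scope.
Local Open Scope ring_scope.

(** Write N = n + 1, c = cos (pi / N) and tau = tan (pi / (2 N)) ^ 2, which is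
    (1 - c) / (1 + c).  In the variable x = cos t one has S(t) = sin t P(x) and
    C(t) = C(x) for polynomials P (of degree at most n - 1) and C, so the zeros
    of S correspond to x = 1, x = -1 and the roots of P in [-1, 1]; the set of
    such x is compact, hence the minimum exists.

    Let E f be the average of f over the points cos ((2 k + 1) pi / N), k < N.
    This Gauss-Chebyshev rule is exact up to the degree n, and conjugation of
    trigonometric polynomials takes the form
      C(1) = E ((x + 1) P),   C(-1) = E ((x - 1) P),
      C(z) = E ((x^2 - 1) P / (x - z))   at a root z of P
    (lemmas [conj_1], [conj_N1], [conj_root]).

    Upper bound.  Suppose that al, be and the lam_z are nonnegative weights of
    sum 1, and let
      g(x) = al (x + 1) + be (x - 1) + sum_z lam_z (x^2 - 1) / (x - z),
    the z being roots of P.  Then al C(1) + be C(-1) + sum_z lam_z C(z) is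
    E (P g).  If P g <= 0 at all quadrature nodes and al >= (1 - c) / 2, then
    C(1) = 1 forces some value of C at a zero of S to be at most
    - al / (1 - al) <= - tau.  Such a g exists ([corrector_exists]).  It has
    the form
      g(x) = (x - y0) prod_i (x - v_i) / (x - u_i),
      c >= y0 > u_1 > v_1 > u_2 > ... >= -1,
    where the sign changes follow those of P along the decreasing list of nodes,
    all of them at most c.  A pole u_i must be a root of P; it is placed where P
    turns from positive to negative as x decreases, a zero v_i where P turns
    back.  The interlacing makes all the weights nonnegative
    ([corrector_step]), and each pair can only increase al from its initial
    value (1 - y0) / 2.

    Lower bound.  If P > 0 on [-1, 1], the zeros of S are those of sin t and the
    minimum is C(-1).  Take h_k = sin (k pi / N) for 1 <= k <= n, an eigenvector
    of the adjacency matrix of a path with eigenvalue 2 c, and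
      P(cos t) = |sum_k h_k e^(i k t)|^2 + e,   e > 0.
    Before normalization C(1) = (1 + c) A + e and C(-1) = - (1 - c) A - e, where
    A is the sum of the h_k^2, so the ratio C(-1) / C(1) tends to - tau as e
    tends to 0. *)

(** * Rational functions that correct the signs of a polynomial *)

Section Corrector.
Variable R : realType.
Implicit Types (P G : {poly R}) (L : seq (R * R)) (x y u v z : R).

(** Equivalently P vanishes at z and P'(z) >= 0; the quotient is what enters
    the quadrature when a node happens to be a root of P. *)
Definition rising_root P z :=
  exists2 G, P = ('X - z%:P) * G & 0 <= G.[z].

Lemma rising_root_root P z : rising_root P z -> P.[z] = 0.
Proof. by case=> G -> _; rewrite hornerM hornerXsubC subrr mul0r. Qed.

(** The intermediate value theorem gives a root w.  If the quotient by X - w is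
    negative at w, that quotient satisfies the same hypotheses on (w, y) with a
    smaller degree, and its rising roots are rising roots of P. *)
Lemma exists_rising_root P x y :
  x < y -> P.[x] < 0 -> 0 < P.[y] ->
  exists u, [/\ x < u, u < y & rising_root P u].
Proof.
have [m] := ubnP (size P); elim: m P x => // m IH P x sP xy Px Py.
have P0 : P != 0 by apply: contraTneq Py => ->; rewrite horner0 ltxx.
have [w /andP[xw wy] /factor_theorem [G PG]] :
    exists2 w, x <= w <= y & root P w.
  by apply: poly_ivt; [exact: ltW|rewrite (ltW Px) (ltW Py)].
have {}PG : P = ('X - w%:P) * G by rewrite PG mulrC.
have Pw : P.[w] = 0 by rewrite PG hornerM hornerXsubC subrr mul0r.
have {}xw : x < w.
  by rewrite lt_neqAle xw andbT; apply: contraTneq Px => ->; rewrite Pw ltxx.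
have {}wy : w < y.
  by rewrite lt_neqAle wy andbT; apply: contraTneq Py => <-; rewrite Pw ltxx.
have [Gw|Gw] := lerP 0 G.[w]; first by exists w; split=> //; exists G.
have Gy : 0 < G.[y].
  by move: Py; rewrite PG hornerM hornerXsubC pmulr_rgt0 // subr_gt0.
have sG : (size G < m)%N.
  have G0 : G != 0 by apply: contraTneq Gy => ->; rewrite horner0 ltxx.
  by move: sP; rewrite PG size_monicM ?monicXsubC // size_XsubC.
have [u [wu uy [H GH Hu]]] := IH G w sG wy Gw Gy.
exists u; split=> //; first exact: lt_trans wu.
exists (('X - w%:P) * H); first by rewrite PG GH mulrCA.
by rewrite hornerM hornerXsubC mulr_ge0 // subr_ge0 ltW.
Qed.

(** The pair (lam, z) of L stands for a pole z with weight lam.  The terms of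
    al and be are those of the poles 1 and -1, where (x^2 - 1) / (x - z)
    simplifies: kept apart, they remain meaningful at the node x = -1. *)
Definition lobatto_sum (al be : R) L x :=
  al * (x + 1) + be * (x - 1) +
  \sum_(w <- L) w.1 * ((x ^+ 2 - 1) / (x - w.2)).

Definition admissible P (s al be : R) L :=
  [/\ s <= al, 0 <= be, al + be + \sum_(w <- L) w.1 = 1 &
      {in L, forall w, [/\ 0 <= w.1, `|w.2| < 1 & rising_root P w.2]}].

(** A function g agreeing with an admissible sum of which all poles exceed p.
    Agreement is required only where no pole can interfere: away from the roots
    of P, and below p.  This lets g be manipulated as a plain product. *)
Definition corrector P (s p : R) (g : R -> R) :=
  exists al be L, [/\ admissible P s al be L, {in L, forall w, p < w.2} &
    forall x, (P.[x] != 0) || (x <= p) -> g x = lobatto_sum al be L x].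

Lemma corrector_base P s p y0 : -1 <= y0 <= 1 -> s <= (1 - y0) / 2 ->
  corrector P s p (fun x => x - y0).
Proof.
move=> /andP[y1 y2] sy; exists ((1 - y0) / 2), ((1 + y0) / 2), [::].
split=> //; first by split=> //; [lra|rewrite big_nil; field].
by move=> x _; rewrite /lobatto_sum big_nil; field.
Qed.

Lemma corrector_le P s p q g : q <= p -> corrector P s p g ->
  corrector P s q g.
Proof.
move=> qp [al [be [L [adm Lp gE]]]]; exists al, be, L; split=> //.
  by move=> w /Lp; apply: le_lt_trans.
by move=> x /orP[Px|xq]; apply: gE; rewrite ?Px // (le_trans xq) ?orbT.
Qed.

(** Multiplying by (x - v) / (x - u) acts on the weights by partial fractions.
    A pole z > u gets the factor (z - v) / (z - u) >= 0, and likewise for 1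
    and -1; for 1 this factor is at least 1, so that the lower bound on al
    survives.  The new pole u gets the weight (u - v) g(u) / (u^2 - 1), which
    is nonnegative because g(u) <= 0. *)
Lemma corrector_step P s p u v g : corrector P s p g -> 0 <= s ->
  -1 <= v -> v < u -> u < p -> u < 1 -> rising_root P u -> g u <= 0 ->
  corrector P s v (fun x => g x * ((x - v) / (x - u))).
Proof.
move=> [al [be [L [[sal be0 sum1 HL] Lp gE]]]] s0 v1 vu up u1 Pu gu.
have gu' : g u = lobatto_sum al be L u by rewrite gE // (ltW up) orbT.
have uN1 : u + 1 != 0 by lra.
have uN2 : u - 1 != 0 by lra.
have uN3 : 1 - u != 0 by lra.
have uN4 : 1 + u != 0 by lra.
have uN5 : u ^+ 2 - 1 != 0.
  by rewrite (_ : _ - 1 = (u - 1) * (u + 1)) ?mulf_neq0 //; ring.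
have Lu w : w \in L -> u < w.2 by move/Lp; apply: lt_trans.
pose lu := (u - v) * (g u / (u ^+ 2 - 1)).
have luE : lu = (u - v) * (al / (u - 1) + be / (u + 1) +
                \sum_(w <- L) w.1 / (u - w.2)).
  rewrite /lu; have -> : g u = al * (u + 1) + be * (u - 1) +
                  (u ^+ 2 - 1) * \sum_(w <- L) w.1 / (u - w.2).
    rewrite gu' /lobatto_sum mulr_sumr; congr (_ + _).
    by apply: eq_bigr => w _; rewrite mulrCA mulrA.
  by field; rewrite uN5 uN1 uN2.
have al0 : 0 <= al by exact: le_trans sal.
exists (al * ((1 - v) / (1 - u))), (be * ((1 + v) / (1 + u))).
exists ((lu, u) :: [seq (w.1 * ((w.2 - v) / (w.2 - u)), w.2) | w <- L]).
split.
- split.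
  + apply: (le_trans sal); rewrite ler_peMr // ler_pdivlMr; lra.
  + by rewrite mulr_ge0 // divr_ge0 //; lra.
  + rewrite big_cons big_map /= luE -[RHS]sum1.
    have -> : \sum_(w <- L) w.1 * ((w.2 - v) / (w.2 - u)) =
       \sum_(w <- L) w.1 - (u - v) * \sum_(w <- L) w.1 / (u - w.2).
      rewrite mulr_sumr -sumrB !big_seq; apply: eq_bigr => w wL.
      have := Lu _ wL => h; field.
      by rewrite !subr_eq0 (lt_eqF h) (gt_eqF h).
    by field; rewrite ?uN1 ?uN2 ?uN3 ?uN4.
  + move=> w; rewrite inE => /predU1P[->|/mapP[w' w'L ->]] /=.
      split=> //; last by rewrite ltr_norml; lra.
      rewrite /lu mulr_ge0 //; first lra.
      rewrite mulr_le0 // invr_le0.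
      have : 0 < (1 - u) * (u + 1) by rewrite mulr_gt0 //; lra.
      by nra.
    have [w0 wn wr] := HL _ w'L; have := Lu _ w'L => h; split=> //.
    by rewrite mulr_ge0 // divr_ge0 //; lra.
- move=> w; rewrite inE => /predU1P[-> //|/mapP[w' w'L ->]] /=.
  exact: lt_trans (Lu _ w'L).
move=> x Hx.
have xu : x - u != 0.
  rewrite subr_eq0; case/orP: Hx => [|xv].
    by apply: contraNneq => ->; rewrite rising_root_root.
  by rewrite lt_eqF // (le_lt_trans xv).
have xL w : w \in L -> x - w.2 != 0.
  move=> wL; rewrite subr_eq0; case/orP: Hx => [|xv].
    by apply: contraNneq => ->; have [_ _ /rising_root_root ->] := HL _ wL.
  by rewrite lt_eqF // (le_lt_trans xv) // (lt_trans vu (Lu _ wL)).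
rewrite gE; last first.
  by case/orP: Hx => [-> //|xv]; rewrite (le_trans xv) ?orbT // ltW // (lt_trans vu).
rewrite /lobatto_sum big_cons big_map /= luE.
have -> : \sum_(w <- L) w.1 * ((w.2 - v) / (w.2 - u)) *
             ((x ^+ 2 - 1) / (x - w.2)) =
  (x - v) / (x - u) * (\sum_(w <- L) w.1 * ((x ^+ 2 - 1) / (x - w.2))) -
  (u - v) * ((x ^+ 2 - 1) / (x - u)) * (\sum_(w <- L) w.1 / (u - w.2)).
  rewrite !mulr_sumr -sumrB !big_seq; apply: eq_bigr => w wL.
  have := Lu _ wL => h; field.
  by rewrite xu (xL _ wL) !subr_eq0 (lt_eqF h) (gt_eqF h).
by field; rewrite xu ?uN1 ?uN2 ?uN3 ?uN4.
Qed.

Let desc := path (fun x y : R => y <= x).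

(* [lra] on goals and hypotheses containing two-sided inequalities *)
Ltac slra := repeat match goal with
  | H : is_true (_ && _) |- _ => let H1 := fresh in let H2 := fresh in
                                 move/andP: H => [H1 H2]
  | |- is_true (_ && _) => apply/andP; split
  end; lra.

(** The scan of the decreasing list xs of nodes still to be treated, as a
    simultaneous induction on its two states.  In the first one P is positive at
    the last relevant node p and the current g is nonpositive up to p.  In the
    second one P has become negative: a pole u has been chosen between p and the
    last negative node x, but the matching zero v is placed only when P becomes
    positive again, so g is still the function from before the pole.  The last
    clauses compare the final g' with g on the part already scanned, so that the
    sign conditions obtained there persist. *)
Lemma corrector_scan P s xs : 0 <= s -> all (fun x => -1 <= x) xs ->
  (forall p g, corrector P s p g -> p < 1 -> 0 < P.[p] ->
     (forall x, -1 <= x <= p -> g x <= 0) -> desc p xs ->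
   exists q g', [/\ corrector P s q g',
     {in xs, forall x, P.[x] * g' x <= 0} &
     forall y, p <= y -> exists2 k, 0 <= k & g' y = k * g y]) /\
  (forall p g x u, corrector P s p g -> p < 1 ->
     (forall x, -1 <= x <= p -> g x <= 0) ->
     -1 <= x -> x < u -> u < p -> P.[x] < 0 -> rising_root P u -> desc x xs ->
   exists q g', [/\ corrector P s q g',
     {in xs, forall x, P.[x] * g' x <= 0},
     forall y, p <= y -> exists2 k, 0 <= k & g' y = k * g y &
     forall y, x <= y < u -> exists2 k, k <= 0 & g' y = k * g y]).
Proof.
move=> s0; elim: xs => [_|y xs IH /= /andP[y1 xs1]].
  split=> [p g cg p1 Pp gneg _|p g x u cg p1 gneg x1 xu up Px Pu _].
    by exists p, g; split=> // y _; exists 1; rewrite ?mul1r.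
  exists x, (fun y => g y * ((y - x) / (y - u))); split=> //.
  - by apply: (corrector_step P s p u x) => //; [slra|apply: gneg; slra].
  - move=> y py; exists ((y - x) / (y - u)); last by rewrite mulrC.
    by rewrite divr_ge0 //; slra.
  - move=> y /andP[xy yu]; exists ((y - x) / (y - u)); last by rewrite mulrC.
    by rewrite mulr_ge0_le0 ?invr_le0 //; slra.
have {IH} [IHA IHB] := IH xs1.
have desc_le a b l : b <= a -> desc b l -> desc a l.
  by case: l => //= c l ba /andP[cb ->]; rewrite (le_trans cb).
split=> [p g cg p1 Pp gneg /andP[yp dxs]|p g x u cg p1 gneg x1 xu up Px Pu].
- have [Py|Py|Py] := ltgtP P.[y] 0.
  + have {}yp : y < p.
      by rewrite lt_neqAle yp andbT; apply: contraTneq Py => ->; rewrite -leNgt ltW.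
    (* P turns negative between p and y: a pole is needed there. *)
    have [u [yu up Pu]] := exists_rising_root P y p yp Py Pp.
    have [q [g' [cg' g'xs g'p g'y]]] := IHB p g y u cg p1 gneg y1 yu up Py Pu dxs.
    exists q, g'; split=> // z; rewrite inE => /predU1P[->|]; last exact: g'xs.
    have [|k k0 ->] := g'y y; first by rewrite lexx.
    rewrite mulr_le0_ge0 ?(ltW Py) // mulr_le0 // gneg // y1 /=; exact: ltW.
  + have cgy := corrector_le P s p y g yp cg.
    have gnegy x : -1 <= x <= y -> g x <= 0 by move=> ?; apply: gneg; slra.
    have [q [g' [cg' g'xs g'y]]] := IHA y g cgy (le_lt_trans yp p1) Py gnegy dxs.
    exists q, g'; split=> //.
      move=> z; rewrite inE => /predU1P[->|]; last exact: g'xs.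
      have [k k0 ->] := g'y y (lexx y).
      rewrite pmulr_rle0 // mulr_ge0_le0 // gneg //; slra.
    by move=> z pz; apply: g'y; apply: le_trans pz.
  + have [q [g' [cg' g'xs g'y]]] := IHA p g cg p1 Pp gneg (desc_le _ _ _ yp dxs).
    exists q, g'; split=> // z; rewrite inE => /predU1P[->|]; last exact: g'xs.
    by rewrite Py mul0r.
- move=> /andP[yx dxs].
  have [Py|Py|Py] := ltgtP P.[y] 0.
  + have [q [g' [cg' g'xs g'p g'y]]] :=
      IHB p g y u cg p1 gneg y1 (le_lt_trans yx xu) up Py Pu dxs.
    exists q, g'; split=> //; last by move=> z hz; apply: g'y; slra.
    move=> z; rewrite inE => /predU1P[->|]; last exact: g'xs.
    have [|k k0 ->] := g'y y; first by rewrite lexx (le_lt_trans yx).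
    rewrite mulr_le0_ge0 ?(ltW Py) // mulr_le0 // gneg // y1 /=; slra.
  + have {}yx : y < x.
      by rewrite lt_neqAle yx andbT; apply: contraTneq Py => ->; rewrite -leNgt ltW.
    (* P is positive again at y: the matching zero is the last negative node. *)
    pose g1 z := g z * ((z - x) / (z - u)).
    have cg1 : corrector P s y g1.
      apply: (corrector_le P s x y) (ltW yx) _.
      by apply: (corrector_step P s p u x) => //; [slra|apply: gneg; slra].
    have g1neg z : -1 <= z <= y -> g1 z <= 0.
      move=> hz; rewrite /g1 mulr_le0_ge0 //; first by apply: gneg; slra.
      by rewrite mulr_le0 ?invr_le0 //; slra.
    have [|q [g' [cg' g'xs g'y]]] := IHA y g1 cg1 _ Py g1neg dxs; first slra.
    exists q, g'; split=> //.
    * move=> z; rewrite inE => /predU1P[->|]; last exact: g'xs.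
      have [k k0 ->] := g'y y (lexx y).
      by rewrite pmulr_rle0 // mulr_ge0_le0 // g1neg // y1 lexx.
    * move=> z pz; have [|k k0 ->] := g'y z; first slra.
      exists (k * ((z - x) / (z - u))); last by rewrite /g1; ring.
      by rewrite mulr_ge0 // divr_ge0 //; slra.
    * move=> z xzu; have [|k k0 ->] := g'y z; first slra.
      exists (k * ((z - x) / (z - u))); last by rewrite /g1; ring.
      by rewrite mulr_ge0_le0 // mulr_ge0_le0 ?invr_le0 //; slra.
  + have [q [g' [cg' g'xs g'p g'y]]] :=
      IHB p g x u cg p1 gneg x1 xu up Px Pu (desc_le _ _ _ yx dxs).
    exists q, g'; split=> // z; rewrite inE => /predU1P[->|]; last exact: g'xs.
    by rewrite Py mul0r.
Qed.

(** The scan starts with g(x) = x - y0, where y0 is the last node of the initial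
    run on which P is nonpositive, or c if there is no such run; as y0 <= c, the
    weight (1 - y0) / 2 of the pole 1 is large enough. *)
Lemma corrector_exists P c xs : -1 <= c < 1 ->
  all (fun x => -1 <= x <= c) xs ->
  exists q g, corrector P ((1 - c) / 2) q g /\
     {in xs, forall x, P.[x] * g x <= 0}.
Proof.
move=> /andP[c1 c2] hxs.
pose ys := sort (fun x y : R => y <= x) xs.
have ysx : ys =i xs by exact: mem_sort.
have hys : {in ys, forall y, -1 <= y <= c}.
  by move=> y; rewrite ysx => /(allP hxs).
have dys : desc c ys.
  rewrite /desc path_sortedE; last by move=> a b d ab bd; apply: le_trans ab.
  rewrite sort_sorted ?andbT; last by move=> a b; rewrite orbC le_total.
  by apply/allP => y /hys /andP[].
suff /(_ ys c dys) [||q [g [cg gys _]]] : forall ys x, desc x ys ->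
     all (fun y => -1 <= y) ys -> -1 <= x <= c ->
   exists q g, [/\ corrector P ((1 - c) / 2) q g,
     {in ys, forall x, P.[x] * g x <= 0} & forall y, x <= y -> 0 <= g y].
- by apply/allP => y /hys /andP[].
- by rewrite c1 lexx.
- by exists q, g; split=> // x; rewrite -ysx; apply: gys.
elim=> {ys ysx hys dys} [|y ys IH] x dys.
  move=> _ xc; exists 0, (fun y => y - x); split=> //; last by move=> y; slra.
  by apply: corrector_base; slra.
move=> /= /andP[y1 ys1] xc; case/andP: dys => yx dys.
have [Py|Py] := lerP P.[y] 0.
  have [||q [g [cg gys gy]]] := IH y dys; rewrite ?y1 //; first slra.
  exists q, g; split=> //; last by move=> z xz; apply: gy; slra.
  move=> z; rewrite inE => /predU1P[->|]; last exact: gys.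
  by rewrite mulr_le0_ge0 // gy.
have s0 : 0 <= (1 - c) / 2 by slra.
have [A _] := corrector_scan P _ ys s0 ys1.
have cg : corrector P ((1 - c) / 2) y (fun z => z - x).
  by apply: corrector_base; slra.
have [||q [g [cg' gys gy]]] := A _ _ cg _ Py _ dys; first slra.
  by move=> z; slra.
exists q, g; split=> //.
  move=> z; rewrite inE => /predU1P[->|]; last exact: gys.
  have [k k0 ->] := gy y (lexx y).
  by rewrite pmulr_rle0 // mulr_ge0_le0 //; slra.
move=> z xz; have [|k k0 ->] := gy z; first slra.
by rewrite mulr_ge0 //; slra.
Qed.

End Corrector.

(** * Chebyshev polynomials and the quadrature rule *)

Section Conjugate.
Variable R : realType.
Implicit Types (t x z : R) (f P G : {poly R}).

(** Chebyshev polynomials of the second kind with the index shifted by one, so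
    that sin (j t) = sin t * cheb j (cos t) for all j. *)
Fixpoint cheb (j : nat) : {poly R} :=
  match j with
  | 0 => 0
  | 1 => 1
  | (j'.+1 as i).+1 => 2%:P * 'X * cheb i - cheb j'
  end.

Lemma chebSS j : cheb j.+2 = 2%:P * 'X * cheb j.+1 - cheb j.
Proof. by []. Qed.

Lemma sinSS t (j : nat) :
  sin (j.+2%:R * t) = 2 * cos t * sin (j.+1%:R * t) - sin (j%:R * t).
Proof.
have -> : j.+2%:R * t = j.+1%:R * t + t by rewrite -[in LHS]natr1; ring.
have -> : j%:R * t = j.+1%:R * t - t by rewrite -[in RHS]natr1; ring.
by rewrite sinD sinB; ring.
Qed.

Lemma cosSS t (j : nat) :
  cos (j.+2%:R * t) = 2 * cos t * cos (j.+1%:R * t) - cos (j%:R * t).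
Proof.
have -> : j.+2%:R * t = j.+1%:R * t + t by rewrite -[in LHS]natr1; ring.
have -> : j%:R * t = j.+1%:R * t - t by rewrite -[in RHS]natr1; ring.
by rewrite cosD cosB; ring.
Qed.

Lemma sin_cheb t j : sin (j%:R * t) = sin t * (cheb j).[cos t].
Proof.
suff: sin (j%:R * t) = sin t * (cheb j).[cos t] /\
      sin (j.+1%:R * t) = sin t * (cheb j.+1).[cos t] by case.
elim: j => [|j [IH1 IH2]].
  by rewrite /= mul0r sin0 mul1r hornerE mulr0 hornerE mulr1.
by split=> //; rewrite sinSS chebSS IH1 IH2 !hornerE /=; ring.
Qed.

Lemma cos_cheb t j :
  cos (j.+1%:R * t) = cos t * (cheb j.+1).[cos t] - (cheb j).[cos t].
Proof.
have -> : j.+1%:R * t = j%:R * t + t by rewrite -[in LHS]natr1; ring.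
suff: cos (j%:R * t + t) = cos t * (cheb j.+1).[cos t] - (cheb j).[cos t] /\
  cos (j.+1%:R * t + t) = cos t * (cheb j.+2).[cos t] - (cheb j.+1).[cos t].
  by case.
elim: j => [|j [IH1 IH2]].
  rewrite /= mul0r mul1r add0r cosD !hornerE -!expr2 sin2cos2; split; ring.
split=> //.
have E (i : nat) : i%:R * t + t = i.+1%:R * t by rewrite -natr1; ring.
move: IH1 IH2; rewrite !E => IH1 IH2.
rewrite cosSS IH1 IH2 [cheb j.+3]chebSS.
have := chebSS j; move: (cheb j.+2) (cheb j.+1) (cheb j) => p q r ->.
by rewrite !hornerE; ring.
Qed.

(** The divided difference (cheb j - cheb j (z)) / (X - z), by the recurrence of
    [cheb]: this form makes its quadrature immediate by induction. *)
Fixpoint cheb_diff z (j : nat) : {poly R} :=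
  match j with
  | 0 => 0
  | 1 => 0
  | (j'.+1 as i).+1 => (2 * z)%:P * cheb_diff z i - cheb_diff z j' + 2%:P * cheb i
  end.

Lemma cheb_diffSS z j : cheb_diff z j.+2 =
  (2 * z)%:P * cheb_diff z j.+1 - cheb_diff z j + 2%:P * cheb j.+1.
Proof. by []. Qed.

Lemma cheb_diffE z j :
  cheb j - ((cheb j).[z])%:P = ('X - z%:P) * cheb_diff z j.
Proof.
suff: cheb j - ((cheb j).[z])%:P = ('X - z%:P) * cheb_diff z j /\
  cheb j.+1 - ((cheb j.+1).[z])%:P = ('X - z%:P) * cheb_diff z j.+1 by case.
elim: j => [|j [IH1 IH2]].
  by rewrite /= !hornerE ?mulr0 ?polyC0 ?polyC1 ?subrr ?oppr0.
split=> //; rewrite chebSS cheb_diffSS.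
rewrite mulrDr mulrBr [in RHS]mulrCA -IH2 -IH1.
by rewrite !(hornerD, hornerN, hornerM, hornerC, hornerX) !(polyCB, polyCM); ring.
Qed.

Variable N : nat.
Hypothesis N1 : (1 < N)%N.

Definition node (k : nat) : R := k.*2.+1%:R * (pi / N%:R).

Definition quad f : R := N%:R^-1 * \sum_(k < N) f.[cos (node k)].

Lemma quadD f g : quad (f + g) = quad f + quad g.
Proof.
rewrite /quad -mulrDr -big_split /=; congr (_ * _).
by apply: eq_bigr => k _; rewrite hornerD.
Qed.

Lemma quadZ (a : R) f : quad (a%:P * f) = a * quad f.
Proof.
rewrite /quad mulrCA; congr (_ * _); rewrite mulr_sumr.
by apply: eq_bigr => k _; rewrite hornerM hornerC.
Qed.

Lemma quadB f g : quad (f - g) = quad f - quad g.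
Proof. by rewrite quadD -[- g]mulN1r -polyCN quadZ mulN1r. Qed.

Lemma quad0 : quad 0 = 0.
Proof. by rewrite -[0](mul0r 0) -polyC0 quadZ mul0r. Qed.

Lemma quad_sum (I : Type) (r : seq I) (F : I -> {poly R}) :
  quad (\sum_(i <- r) F i) = \sum_(i <- r) quad (F i).
Proof. exact: (big_morph _ quadD quad0). Qed.

Lemma N_neq0 : N%:R != 0 :> R.
Proof. by rewrite pnatr_eq0 -lt0n ltnW. Qed.

(** Multiplied by 2 sin (j pi / N), the sum telescopes. *)
Lemma sum_cos_node (j : nat) : (0 < j < N)%N ->
  \sum_(k < N) cos (j%:R * node k) = 0.
Proof.
move=> /andP[j0 jN]; have N0 := N_neq0.
pose h : R := j%:R * (pi / N%:R).
have hpi : 0 < h < pi.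
  rewrite /h mulr_gt0 ?ltr0n // ?divr_gt0 ?pi_gt0 ?ltr0n ?(ltnW N1) //=.
  by rewrite mulrCA gtr_pMr ?pi_gt0 // ltr_pdivrMr ?ltr0n ?(ltnW N1) // mul1r ltr_nat.
have sh := sin_gt0_pi hpi.
apply: (mulfI (x := 2 * sin h)); first by rewrite mulf_neq0 ?pnatr_eq0 ?gt_eqF.
rewrite mulr0 mulr_sumr.
have E k : 2 * sin h * cos (j%:R * node k) =
    sin (h * k.+1.*2%:R) - sin (h * k.*2%:R).
  have -> : j%:R * node k = h * k.*2.+1%:R by rewrite /node /h; ring.
  have -> : h * k.+1.*2%:R = h * k.*2.+1%:R + h.
    by rewrite doubleS -[in LHS]natr1; ring.
  have -> : h * k.*2%:R = h * k.*2.+1%:R - h by rewrite -[in RHS]natr1; ring.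
  by rewrite sinD sinB; ring.
under eq_bigr do rewrite E.
rewrite -(big_mkord xpredT (fun k => sin (h * k.+1.*2%:R) - sin (h * k.*2%:R))).
rewrite telescope_sumr // mulr0 sin0 subr0.
have -> : h * N.*2%:R = 0 + pi *+ 2 *+ j.
  by rewrite /h -muln2 natrM -[_ *+ j]mulr_natr -[pi *+ 2]mulr_natr add0r; field.
by rewrite (periodicn (@sinD2pi R)) sin0.
Qed.

Lemma quad_cos f (F : R -> R) : (forall t, f.[cos t] = F t) ->
  quad f = N%:R^-1 * \sum_(k < N) F (node k).
Proof. by move=> fF; rewrite /quad; under eq_bigr do rewrite fF. Qed.

Lemma quadC a : quad a%:P = a.
Proof.
rewrite /quad; under eq_bigr do rewrite hornerC.
by rewrite sumr_const card_ord -[a *+ N]mulr_natl mulKf ?N_neq0.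
Qed.

Lemma quadX : quad 'X = 0.
Proof.
rewrite (quad_cos _ (fun t => cos (1%:R * t))); last by move=> t; rewrite hornerX mul1r.
by rewrite sum_cos_node ?mulr0 // N1.
Qed.

(** Up to sign, (x^2 - 1) cheb (i + 1) is sin t sin ((i + 1) t), a difference of
    two cosines of frequencies i and i + 2. *)
Lemma quad_cheb (i : nat) : (i.+2 < N)%N ->
  quad (('X^2 - 1) * cheb i.+1) = - ((i == 0)%N%:R / 2).
Proof.
move=> iN.
rewrite (quad_cos _ (fun t => 2^-1 * cos (i.+2%:R * t) - 2^-1 * cos (i%:R * t))).
  rewrite sumrB -!mulr_sumr sum_cos_node ?iN // mulr0 sub0r mulrN; congr (- _).
  case: i iN => [_|i iN].
    under eq_bigr do rewrite mul0r cos0.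
    by rewrite sumr_const card_ord eqxx mulr1n; field; apply: N_neq0.
  by rewrite sum_cos_node ?mulr0 ?mul0r //= (ltn_trans _ iN).
move=> t; have -> : i.+2%:R * t = i.+1%:R * t + t by rewrite -[in LHS]natr1; ring.
have -> : i%:R * t = i.+1%:R * t - t by rewrite -[in RHS]natr1; ring.
rewrite hornerM hornerD hornerN hornerXn hornerC cosD cosB sin_cheb.
by have -> : cos t ^+ 2 - 1 = - sin t ^+ 2 by [rewrite sin2cos2; ring]; field.
Qed.

Lemma quad_cheb_diff z j : (j.+1 < N)%N ->
  quad (('X^2 - 1) * cheb_diff z j.+1) = - (cheb j).[z].
Proof.
suff H : ((j.+1 < N)%N -> quad (('X^2 - 1) * cheb_diff z j.+1) = - (cheb j).[z]) /\
  ((j.+2 < N)%N -> quad (('X^2 - 1) * cheb_diff z j.+2) = - (cheb j.+1).[z]).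
  by case: H.
elim: j => [|j [IH1 IH2]].
  split=> [_|N2]; first by rewrite /= mulr0 quad0 horner0 oppr0.
  rewrite cheb_diffSS /= !mulr0 oppr0 !add0r mulrCA quadZ.
  by rewrite (quad_cheb 0) // hornerC eqxx mulr1n; field.
split=> // jN; have jN' := ltnW jN.
rewrite cheb_diffSS mulrDr mulrBr mulrCA [('X^2 - 1) * (2%:P * _)]mulrCA.
rewrite quadD quadB !quadZ IH2 // IH1 ?(ltnW jN') // quad_cheb //.
rewrite chebSS !(hornerD, hornerN, hornerM, hornerC, hornerX) /=; ring.
Qed.

End Conjugate.

(** * Conjugation expressed by quadrature *)

Section Transfer.
Variables (R : realType) (n : nat).
Hypothesis n1 : (1 <= n)%N.
Variable a : 'I_n -> R.
Implicit Types (t x z : R) (P G : {poly R}).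

(** The polynomials P and C of the variable cos t with S(t) = sin t P(cos t) and
    C(t) = C(cos t). *)
Definition sine_quot : {poly R} := \sum_(j < n) (a j)%:P * cheb R j.+1.
Definition cosine_alg : {poly R} :=
  'X * sine_quot - \sum_(j < n) (a j)%:P * cheb R j.

Let P := sine_quot.
Let quadN := quad R n.+1.

Lemma sine_polyE t : sine_poly a t = sin t * P.[cos t].
Proof.
rewrite /sine_poly /P /sine_quot horner_sum mulr_sumr; apply: eq_bigr => j _.
by rewrite sin_cheb hornerM hornerC mulrCA.
Qed.

Lemma cosine_polyE t : cosine_poly a t = cosine_alg.[cos t].
Proof.
rewrite /cosine_poly /cosine_alg /sine_quot hornerD hornerN hornerM hornerX.
rewrite !horner_sum mulr_sumr -sumrB; apply: eq_bigr => j _.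
by rewrite cos_cheb !hornerM hornerC mulrBr mulrCA.
Qed.

Let D z := \sum_(j < n) (a j)%:P * cheb_diff R z j.+1.

Let quad_diff z : quadN (('X^2 - 1) * D z) = cosine_alg.[z] - z * P.[z].
Proof.
rewrite /D mulr_sumr /quadN quad_sum /cosine_alg hornerD hornerN hornerM hornerX.
rewrite addrAC subrr add0r horner_sum -sumrN; apply: eq_bigr => j _.
rewrite mulrCA quadZ quad_cheb_diff ?ltnS //.
by rewrite hornerM hornerC mulrN.
Qed.

Let diff_D z : P - P.[z]%:P = ('X - z%:P) * D z.
Proof.
rewrite /P /D /sine_quot horner_sum mulr_sumr rmorph_sum -sumrB /=.
apply: eq_bigr => j _; rewrite hornerM hornerC polyCM -mulrBr.
by rewrite (cheb_diffE R z j.+1) mulrCA.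
Qed.

(** At a root z the quotient of P by X - z is its divided difference, that is,
    the combination of the polynomials [cheb_diff z]. *)
Lemma conj_root z G : P = ('X - z%:P) * G ->
  cosine_alg.[z] = quadN (('X^2 - 1) * G).
Proof.
move=> PG.
have Pz : P.[z] = 0 by rewrite PG hornerM hornerXsubC subrr mul0r.
have -> : G = D z.
  apply: (mulfI (x := 'X - z%:P)); first by rewrite polyXsubC_eq0.
  by rewrite -PG -diff_D Pz polyC0 subr0.
by rewrite quad_diff Pz mulr0 subr0.
Qed.

Lemma conj_1 : cosine_alg.[1] = quadN (('X + 1) * P).
Proof.
have -> : ('X + 1) * P = ('X^2 - 1) * D 1 + P.[1]%:P * 'X + P.[1]%:P.
  have := diff_D 1; rewrite polyC1 => /eqP; rewrite subr_eq => /eqP {1}->; ring.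
rewrite /quadN !quadD quadZ quadX ?quadC ?ltnS //.
by rewrite -/quadN quad_diff; ring.
Qed.

Lemma conj_N1 : cosine_alg.[-1] = quadN (('X - 1) * P).
Proof.
have -> : ('X - 1) * P = ('X^2 - 1) * D (-1) + P.[-1]%:P * 'X - P.[-1]%:P.
  have := diff_D (-1); rewrite polyCN polyC1 => /eqP; rewrite subr_eq => /eqP {1}->; ring.
rewrite /quadN quadB quadD quadZ quadX ?quadC ?ltnS //.
by rewrite -/quadN quad_diff; ring.
Qed.

End Transfer.

(** * Existence of the minimum and the upper bound *)

Section UpperBound.
Variables (R : realType) (n : nat).
Hypothesis n1 : (1 <= n)%N.
Implicit Types (t x z : R) (P G : {poly R}).

Let y : R := pi / n.+1%:R.

Lemma angle_bounds : 0 < y < pi.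
Proof.
rewrite /y divr_gt0 ?pi_gt0 ?ltr0n //=.
by rewrite gtr_pMr ?pi_gt0 // invf_lt1 ?ltr0n // ltr1n ltnS.
Qed.

Lemma cos_angle_bounds : -1 < cos y < 1.
Proof.
have s := sin_gt0_pi angle_bounds; have := cos2Dsin2 y.
have : 0 < sin y ^+ 2 by rewrite exprn_gt0.
by move=> ? ?; apply/andP; split; nra.
Qed.

Lemma tan_half_angle :
  tan (pi / (2 * n.+1%:R)) ^+ 2 = (1 - cos y) / (1 + cos y).
Proof.
set u : R := pi / (2 * n.+1%:R).
have -> : y = u *+ 2.
  by rewrite /u /y -[_ *+ 2]mulr_natr; field; rewrite addrC natr1 pnatr_eq0.
have cu : 0 < cos u.
  apply: cos_gt0_pihalf; have /andP[y0 yp] := angle_bounds.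
  have yu : y = u *+ 2.
    by rewrite /u /y -[_ *+ 2]mulr_natr; field; rewrite addrC natr1 pnatr_eq0.
  by move: y0 yp; rewrite yu mulr2n => *; apply/andP; split; lra.
rewrite cos_mulr2n /tan expr_div_n sin2cos2.
have cu2 : cos u ^+ 2 != 0 by rewrite expf_neq0 // gt_eqF.
have E : 1 + (cos u ^+ 2 *+ 2 - 1) = 2 * cos u ^+ 2 by rewrite mulr2n; ring.
by rewrite E mulr2n; field; rewrite ?cu2 ?gt_eqF.
Qed.

(** With y = pi / N, the difference of the two sides is
    2 sin ((k + 1) y) sin (k y). *)
Lemma cos_node_le (k : nat) : (k < n.+1)%N -> cos (node R n.+1 k) <= cos y.
Proof.
move=> kn.
have N0 : n.+1%:R != 0 :> R by rewrite pnatr_eq0.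
have ynk : n.+1%:R * y = pi by rewrite /y mulrC divfK.
have y0 : 0 <= y by case/andP: angle_bounds => /ltW.
have s1 : 0 <= sin (k.+1%:R * y).
  by rewrite sin_ge0_pi // mulr_ge0 //= -ynk ler_wpM2r // ler_nat.
have s2 : 0 <= sin (k%:R * y).
  by rewrite sin_ge0_pi // mulr_ge0 //= -ynk ler_wpM2r // ler_nat ltnW.
have E1 : node R n.+1 k = k.+1%:R * y + k%:R * y.
  by rewrite /node -/y -mulrDl -natrD addSn addnn.
have E2 : y = k.+1%:R * y - k%:R * y by rewrite -natr1; ring.
rewrite -subr_ge0 E1 [in cos y]E2 cosB cosD.
by have := mulr_ge0 s1 s2; lra.
Qed.

Variable a : 'I_n -> R.
Let P := sine_quot R n a.
Let C := cosine_alg R n a.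

(** The factor x^2 - 1 accounts for the zeros of sin t. *)
Lemma zero_valuesE v : zero_values a v <->
  exists2 x, -1 <= x <= 1 & ((x ^+ 2 - 1) * P.[x] = 0 /\ v = C.[x]).
Proof.
split=> [[t /= St <-]|[x x1 [Px ->]]].
  exists (cos t); first by rewrite cos_geN1 cos_le1.
  split; last exact: cosine_polyE.
  move: St; rewrite sine_polyE -/P => St.
  have -> : cos t ^+ 2 - 1 = - (sin t * sin t) by rewrite -expr2 sin2cos2; ring.
  by rewrite mulNr -mulrA St mulr0 oppr0.
exists (acos x); last by rewrite cosine_polyE acosK // in_itv.
rewrite /= sine_polyE acosK ?in_itv // -/P.
have : (sin (acos x)) ^+ 2 * P.[x] = 0.
  by rewrite sin2cos2 acosK ?in_itv // -[LHS]opprK -mulNr opprB Px oppr0.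
by move=> /eqP; rewrite mulf_eq0 sqrf_eq0 -mulf_eq0 => /eqP.
Qed.

Lemma exists_min : exists m, is_min (zero_values a) m.
Proof.
pose Q := ('X^2 - 1) * P.
have QE x : Q.[x] = (x ^+ 2 - 1) * P.[x].
  by rewrite /Q hornerM hornerD hornerN hornerXn hornerC.
pose A := `[(-1 : R), 1]%classic `&` (horner Q @^-1` [set 0]).
have A0 : A !=set0.
  exists 1; split; first by rewrite /= in_itv /= lexx andbT; lra.
  by rewrite /preimage /= QE; ring.
have cA : compact A.
  apply: compact_closedI; first exact: segment_compact.
  apply: closed_comp; last exact: closed_eq.
  by move=> x _; apply: continuous_horner.
have [|x xA xmin] := @compact_EVT_min R R (horner C) A A0 cA.
  by apply: continuous_subspaceT; apply: continuous_horner.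
have inA z : -1 <= z <= 1 /\ (z ^+ 2 - 1) * P.[z] = 0 <-> z \in A.
  rewrite inE /A /setI /= in_itv /= -QE; split=> -[]; split=> //.
exists C.[x]; move/inA: xA => [x1 Px]; split.
  by apply/zero_valuesE; exists x.
by move=> v /zero_valuesE[z z1 [Pz ->]]; apply: xmin; apply/inA.
Qed.

(** The left-hand side is the quadrature of a polynomial M equal to P g away from
    the roots of P.  At a node x that is a root of P, the only terms of M that
    survive are those of the pole x, and they are nonpositive because x is a
    rising root. *)
Lemma corrector_quad_le0 al be L (s : R) : admissible R P s al be L ->
  {in [seq cos (node R n.+1 k) | k <- iota 0 n.+1],
    forall x, P.[x] != 0 -> P.[x] * lobatto_sum R al be L x <= 0} ->
  al * C.[1] + be * C.[-1] + \sum_(w <- L) w.1 * C.[w.2] <= 0.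
Proof.
move=> [_ _ _ HL] Hx.
pose G (w : R * R) := P %/ ('X - w.2%:P).
have PG w : w \in L -> P = ('X - w.2%:P) * G w.
  move=> /HL[_ _ /rising_root_root Pw]; rewrite mulrC divpK //.
  by rewrite dvdp_XsubCl /root Pw.
have G0 w : w \in L -> 0 <= (G w).[w.2].
  move=> wL; have [_ _ [H PH H0]] := HL _ wL.
  suff -> : G w = H by [].
  by rewrite /G PH mulKp // polyXsubC_eq0.
pose M := al%:P * (('X + 1) * P) + be%:P * (('X - 1) * P) +
  \sum_(w <- L) w.1%:P * (('X^2 - 1) * G w).
have -> : al * C.[1] + be * C.[-1] + \sum_(w <- L) w.1 * C.[w.2] =
          quad R n.+1 M.
  rewrite /M !quadD !quadZ quad_sum /C conj_1 // conj_N1 //; congr (_ + _).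
  rewrite !big_seq; apply: eq_bigr => w wL.
  by rewrite quadZ (conj_root R n n1 a w.2 (G w)) //; exact: PG.
rewrite /quad pmulr_rle0 ?invr_gt0 ?ltr0n //; apply: sumr_le0 => k _.
set x := cos _.
have x1 : x ^+ 2 - 1 <= 0.
  by have := sqr_ge0 (sin (node R n.+1 k)); rewrite sin2cos2 -/x; lra.
have Gx w : w \in L -> P.[x] = (x - w.2) * (G w).[x].
  by move=> /PG {1}->; rewrite hornerM hornerXsubC.
have ME : M.[x] = al * ((x + 1) * P.[x]) + be * ((x - 1) * P.[x]) +
    \sum_(w <- L) w.1 * ((x ^+ 2 - 1) * (G w).[x]).
  rewrite /M !hornerD horner_sum !hornerM !hornerD hornerN !hornerC !hornerX.
  congr (_ + _); apply: eq_bigr => w _.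
  by rewrite !hornerM hornerC hornerD hornerN hornerXn hornerC.
have [Px|Px] := eqVneq P.[x] 0.
  rewrite ME Px !mulr0 !add0r big_seq; apply: sumr_le0 => w wL.
  have [w0 _ _] := HL _ wL.
  rewrite mulr_ge0_le0 // mulr_le0_ge0 //.
  have [->|xw] := eqVneq x w.2; first exact: G0.
  have /eqP := Gx w wL; rewrite Px eq_sym mulf_eq0 subr_eq0 (negPf xw) /=.
  by move=> /eqP ->.
suff -> : M.[x] = P.[x] * lobatto_sum R al be L x.
  apply: Hx => //; apply/mapP; exists (k : nat) => //.
  by rewrite mem_iota ltn_ord.
rewrite ME /lobatto_sum !mulrDr mulr_sumr; congr (_ + _ + _); try ring.
rewrite !big_seq; apply: eq_bigr => w wL.
have xw : x - w.2 != 0.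
  by apply: contraNneq Px => xw; rewrite (Gx w wL) xw mul0r.
by rewrite (Gx w wL); field.
Qed.

Lemma normalized_C1 : normalized a -> C.[1] = 1.
Proof.
move=> na; rewrite -[RHS]na /C -[1](@cos0 R) -cosine_polyE /cosine_poly.
by apply: eq_bigr => j _; rewrite mulr0 cos0 mulr1.
Qed.

Lemma min_upper_bound m : normalized a -> is_min (zero_values a) m ->
  m <= - tan (pi / (2 * n.+1%:R)) ^+ 2.
Proof.
move=> na [_ mlb]; have /andP[c1 c2] := cos_angle_bounds.
have C1 := normalized_C1 na.
have mC z : -1 <= z <= 1 -> (z ^+ 2 - 1) * P.[z] = 0 -> m <= C.[z].
  by move=> z1 Pz; apply: mlb; apply/zero_valuesE; exists z.
set c := cos y in c1 c2.
have c12 : -1 <= c < 1 by rewrite (ltW c1).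
have nodes_c : all (fun x => -1 <= x <= c)
    [seq cos (node R n.+1 k) | k <- iota 0 n.+1].
  apply/allP => _ /mapP[k + ->]; rewrite mem_iota => /andP[_ kn].
  by rewrite cos_geN1 cos_node_le.
have [q [g [[al [be [L [adm _ gE]]]] gneg]]] := corrector_exists R P c _ c12 nodes_c.
have := adm; case=> sal be0 sum1 HL.
have H : al * C.[1] + be * C.[-1] + \sum_(w <- L) w.1 * C.[w.2] <= 0.
  apply: (corrector_quad_le0 _ _ _ _ adm).
  by move=> x xs Px; rewrite -gE ?Px //; apply: gneg.
have mCN1 : m <= C.[-1] by apply: mC; [apply/andP; split; lra|ring].
have mC1 : m <= 1 by rewrite -C1; apply: mC; [apply/andP; split; lra|ring].
have mL : (\sum_(w <- L) w.1) * m <= \sum_(w <- L) w.1 * C.[w.2].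
  rewrite mulr_suml !big_seq; apply: ler_sum => w wL.
  have [w0 w1 /rising_root_root Pw] := HL _ wL.
  rewrite ler_wpM2l // mC ?Pw ?mulr0 //.
  by move: w1; rewrite ltr_norml => /andP[? ?]; apply/andP; split; lra.
rewrite tan_half_angle -/c -mulNr ler_pdivlMr; last lra.
have h1 : be * m <= be * C.[-1] by rewrite ler_wpM2l.
have h2 : al + (1 - al) * m <= 0.
  have -> : 1 - al = be + \sum_(w <- L) w.1 by rewrite -sum1; ring.
  by rewrite mulrDl; move: H; rewrite C1; lra.
have h3 : (1 - c) / 2 * (1 - m) <= al * (1 - m) by rewrite ler_wpM2r // subr_ge0.
by lra.
Qed.

End UpperBound.

(** * The extremal family and the lower bound *)

Section Extremal.
Variables (R : realType) (n : nat).
Hypothesis n1 : (1 <= n)%N.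
Implicit Types (t : R).

Let y : R := pi / n.+1%:R.

Lemma sum_delta (F : nat -> R) (m : nat) :
  \sum_(j < n) F j * (j == m :> nat)%:R = if (m < n)%N then F m else 0.
Proof.
case: ifP => mn; last first.
  rewrite big1 // => j _; case: eqP => [jm|]; rewrite ?mulr0 //.
  by move: (ltn_ord j); rewrite jm mn.
rewrite (bigD1 (Ordinal mn)) //= eqxx mulr1 big1 ?addr0 // => j jm.
by rewrite -[_ == m]/(j == Ordinal mn) (negPf jm) mulr0.
Qed.

(** Coefficients of sin t cos (m t) as a sine polynomial: the entry of index j
    is that of sin ((j + 1) t). *)
Definition sine_cos_coef (m j : nat) : R :=
  match m with
  | 0 => (j == 0)%:R
  | 1 => (j == 1)%:R / 2
  | m'.+2 => ((j == m'.+2)%:R - (j == m')%:R) / 2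
  end.

Lemma sum_sine_cos_coef (F : nat -> R) (m : nat) : (m < n)%N ->
  \sum_(j < n) sine_cos_coef m j * F j =
  match m with 0 => F 0 | 1 => F 1 / 2 | m'.+2 => (F m'.+2 - F m') / 2 end.
Proof.
case: m => [|[|m]] mn /=.
- by under eq_bigr do rewrite mulrC; rewrite sum_delta mn.
- under eq_bigr do rewrite mulrC mulrA.
  by rewrite -mulr_suml sum_delta mn.
under eq_bigr do rewrite mulrC mulrA mulrBr.
by rewrite -mulr_suml sumrB !sum_delta mn (ltn_trans _ mn) // ltnW.
Qed.

Lemma sine_poly_sine_cos (m : nat) t : (m < n)%N ->
  sine_poly (fun j : 'I_n => sine_cos_coef m j) t = sin t * cos (m%:R * t).
Proof.
move=> mn; rewrite /sine_poly (sum_sine_cos_coef (fun j => sin (j.+1%:R * t))) //.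
case: m mn => [|[|m]] mn.
- by rewrite mul1r mul0r cos0 mulr1.
- by rewrite sinSS mul1r mul0r sin0; field.
have -> : m.+3%:R * t = m.+2%:R * t + t by rewrite -[in LHS]natr1; ring.
have -> : m.+1%:R * t = m.+2%:R * t - t by rewrite -[in RHS]natr1; ring.
by rewrite sinD sinB; field.
Qed.

Lemma cos_natpi (k : nat) : cos (k%:R * pi) = (-1) ^+ k :> R.
Proof.
have := alternatingn (@cosDpi R) k 0.
by rewrite add0r cos0 mulr1 mulr_natl.
Qed.

Lemma cosine_poly_pi (a : 'I_n -> R) :
  cosine_poly a pi = \sum_(j < n) a j * (-1) ^+ j.+1.
Proof. by apply: eq_bigr => j _; rewrite cos_natpi. Qed.

Let h (k : nat) : R := sin (k.+1%:R * y).
Let dist (k l : nat) : nat := (k - l) + (l - k).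

(** Coefficients of sin t |sum_k h_k e^(i k t)|^2, expanded as a double sum of
    the h_k h_l sin t cos ((k - l) t). *)
Definition fejer (j : 'I_n) : R :=
  \sum_(k < n) \sum_(l < n) h k * h l * sine_cos_coef (dist k l) j.

Let dist_lt (k l : 'I_n) : (dist k l < n)%N.
Proof. by rewrite /dist; have := ltn_ord k; have := ltn_ord l; lia. Qed.

Let fejer_sum (F : nat -> R) :
  \sum_(j < n) fejer j * F j =
  \sum_(k < n) \sum_(l < n) h k * h l *
    \sum_(j < n) sine_cos_coef (dist k l) j * F j.
Proof.
under eq_bigr do rewrite mulr_suml.
rewrite exchange_big; apply: eq_bigr => k _ /=.
under eq_bigr do rewrite mulr_suml.
rewrite exchange_big; apply: eq_bigr => l _ /=.
by rewrite mulr_sumr; apply: eq_bigr => j _; rewrite mulrA.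
Qed.

Lemma sine_poly_fejer t : sine_poly fejer t =
  sin t * ((\sum_(k < n) h k * cos (k%:R * t)) ^+ 2 +
           (\sum_(k < n) h k * sin (k%:R * t)) ^+ 2).
Proof.
rewrite /sine_poly (fejer_sum (fun j => sin (j.+1%:R * t))).
rewrite !expr2 !big_distrl -big_split /= mulr_sumr; apply: eq_bigr => k _.
rewrite !big_distrr -big_split /= mulr_sumr; apply: eq_bigr => l _.
rewrite -/(sine_poly (fun j : 'I_n => sine_cos_coef (dist k l) j) t).
rewrite sine_poly_sine_cos ?dist_lt //.
have -> : cos ((dist k l)%:R * t) = cos (k%:R * t - l%:R * t).
  rewrite /dist -mulrBl; case: (leqP k l) => [kl|/ltnW kl].
    rewrite (eqP kl) add0n natrB // -cosN; congr cos; ring.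
  by rewrite (eqP kl) addn0 natrB.
rewrite cosB; ring.
Qed.

Let A : R := \sum_(k < n) h k ^+ 2.

Let A_gt0 : 0 < A.
Proof.
have h0 : 0 < h 0 by rewrite /h mul1r sin_gt0_pi // angle_bounds.
rewrite /A (bigD1 (Ordinal n1)) //= ltr_pwDl ?exprn_gt0 //.
by apply: sumr_ge0 => k _; apply: sqr_ge0.
Qed.

(** h is an eigenvector of the path graph on n vertices.  The boundary cases hold
    because sin (k pi / N) vanishes at k = 0 and k = N. *)
Let neighbours (k : 'I_n) :
  \sum_(l < n) h l * (dist k l == 1)%:R = 2 * cos y * h k.
Proof.
have ypi : n.+1%:R * y = pi by rewrite /y mulrC divfK ?pnatr_eq0.
have -> : 2 * cos y * h k = sin (k%:R * y) + sin (k.+2%:R * y).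
  by rewrite (sinSS R y k) /h; ring.
have E (l : 'I_n) : (dist k l == 1)%:R = (l.+1 == k)%:R + (l == k.+1 :> nat)%:R :> R.
  rewrite -natrD; congr (_%:R); rewrite /dist.
  by case: eqP; case: eqP; case: eqP => /=; lia.
under eq_bigr do rewrite E mulrDr.
rewrite big_split /= sum_delta; congr (_ + _).
  case: (k : nat) (ltn_ord k) => [_|k' k'n].
    by rewrite mul0r sin0 big1 // => l _; rewrite mulr0.
  under eq_bigr do rewrite eqSS.
  by rewrite sum_delta ltnW.
case: ifP => // kn.
suff -> : k.+2 = n.+1 by rewrite ypi sinpi.
by have := ltn_ord k; lia.
Qed.

(** The conjugate of sin t cos (m t) vanishes at t = 0 and t = pi for m >= 2, so
    the values at these points of the conjugate of the extremal sine polynomial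
    are of this form. *)
Let quadratic_form (u v : R) :
  \sum_(k < n) \sum_(l < n) h k * h l * ((dist k l == 0)%:R * u + (dist k l == 1)%:R * v)
  = (u + 2 * cos y * v) * A.
Proof.
rewrite /A mulr_sumr; apply: eq_bigr => k _.
have -> : \sum_(l < n) h k * h l * ((dist k l == 0)%:R * u + (dist k l == 1)%:R * v)
   = h k * (\sum_(l < n) h l * (l == k :> nat)%:R) * u +
     h k * (\sum_(l < n) h l * (dist k l == 1)%:R) * v.
  rewrite !mulr_sumr !mulr_suml -big_split; apply: eq_bigr => l _ /=.
  have -> : (dist k l == 0) = (l == k :> nat).
    by rewrite /dist; case: eqP; case: eqP => //; lia.
  ring.
by rewrite neighbours sum_delta ltn_ord; ring.
Qed.

Let fejer_1 : \sum_(j < n) fejer j = (1 + cos y) * A.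
Proof.
have -> : (1 + cos y) * A = (1 + 2 * cos y * (1 / 2)) * A by field.
rewrite -quadratic_form.
under eq_bigr do rewrite -[fejer _]mulr1.
rewrite (fejer_sum (fun=> 1)); apply: eq_bigr => k _; apply: eq_bigr => l _.
rewrite (sum_sine_cos_coef (fun=> 1)) ?dist_lt //; congr (_ * _).
by case: (dist k l) => [|[|m]] /=; rewrite ?eqxx; field.
Qed.

Let fejer_pi : cosine_poly fejer pi = - (1 - cos y) * A.
Proof.
have -> : - (1 - cos y) * A = (-1 + 2 * cos y * (1 / 2)) * A by field.
rewrite -quadratic_form cosine_poly_pi (fejer_sum (fun j => (-1) ^+ j.+1)).
apply: eq_bigr => k _; apply: eq_bigr => l _.
rewrite (sum_sine_cos_coef (fun j => (-1) ^+ j.+1)) ?dist_lt //; congr (_ * _).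
case: (dist k l) => [|[|m]] /=; first by rewrite expr1; ring.
  by rewrite sqrrN expr1n; field.
by rewrite !exprS; field.
Qed.

(** Adding e sin t to the sine polynomial makes it nonzero wherever sin t is, so
    the conjugate is evaluated only where cos t is 1 or -1. *)
Lemma perturbed_min (e : R) : 0 < e ->
  @minima R n (- ((1 - cos y) * A + e) / ((1 + cos y) * A + e)).
Proof.
move=> e0; have /andP[c1 c2] := cos_angle_bounds R n n1; rewrite -/y in c1 c2.
set s := (1 + cos y) * A + e.
have s0 : 0 < s by rewrite addr_gt0 // mulr_gt0 //; lra.
pose a (j : 'I_n) := (fejer j + e * sine_cos_coef 0 j) / s.
have a_sum F : \sum_(j < n) a j * F (j : nat) =
   (\sum_(j < n) fejer j * F j + e * F 0) / s.
  rewrite -(sum_sine_cos_coef F 0) // mulr_sumr -big_split /= mulr_suml.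
  by apply: eq_bigr => j _; rewrite /a /=; ring.
have na : normalized a.
  rewrite /normalized; under eq_bigr do rewrite -[a _]mulr1.
  rewrite (a_sum (fun=> 1)); under eq_bigr do rewrite mulr1.
  by rewrite fejer_1 mulr1 divff // gt_eqF.
have aS t : sine_poly a t = 0 -> sin t = 0.
  rewrite /sine_poly (a_sum (fun j => sin (j.+1%:R * t))).
  rewrite -/(sine_poly fejer t) sine_poly_fejer mul1r [e * _]mulrC -mulrDr.
  move=> /eqP; rewrite !mulf_eq0 invr_eq0 (gt_eqF s0) orbF.
  rewrite [X in _ || X]gt_eqF ?orbF; first by move=> /eqP.
  by rewrite ltr_wpDl // addr_ge0 // sqr_ge0.
have aC : cosine_poly a pi = - ((1 - cos y) * A + e) / s.
  rewrite cosine_poly_pi (a_sum (fun j => (-1) ^+ j.+1)) -cosine_poly_pi fejer_pi.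
  by rewrite expr1; congr (_ / _); ring.
exists a; split=> //; split.
  exists pi => //=; rewrite /sine_poly big1 // => j _.
  by have := sin_cheb R pi j.+1; rewrite sinpi mul0r => ->; rewrite mulr0.
move=> _ [t /= St <-].
have := cosine_polyE R n a t; have := sin0cos1 (aS t St).
case: (ger0P (cos t)) => ct => [->|/eqP]; last rewrite eqr_oppLR => /eqP ->.
  rewrite normalized_C1 // => ->.
  rewrite (le_trans (y := 0)) // mulNr oppr_le0 divr_ge0 ?(ltW s0) //.
  by rewrite addr_ge0 ?(ltW e0) // mulr_ge0 ?(ltW A_gt0) //; lra.
by move=> ->; rewrite -aC cosine_polyE cospi.
Qed.

Lemma minima_lower_bound b : ubound (@minima R n) b ->
  - tan (pi / (2 * n.+1%:R)) ^+ 2 <= b.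
Proof.
move=> ub; rewrite (tan_half_angle R n n1) -/y.
have /andP[c1 c2] := cos_angle_bounds R n n1; rewrite -/y in c1 c2.
have c10 : 0 < 1 + cos y by lra.
rewrite leNgt -mulNr ltr_pdivlMr //; apply/negP => bc.
set d := - (1 - cos y) - b * (1 + cos y).
have d0 : 0 < d by rewrite /d; lra.
have dA0 : 0 < d * A by rewrite mulr_gt0.
pose e := d * A / (2 * (1 + `|b|)).
have b1 : 0 < 1 + `|b| by rewrite ltr_pwDl.
have e0 : 0 < e by rewrite /e divr_gt0 // mulr_gt0.
have := ub _ (perturbed_min e e0); rewrite /= ler_pdivrMr; last first.
  by rewrite addr_gt0 // mulr_gt0.
have : e * (1 + `|b|) = d * A / 2.
  by rewrite /e; field; rewrite gt_eqF.
have : e * b <= e * `|b| by rewrite ler_wpM2l ?ler_norm // ltW.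
by rewrite /d in dA0 *; lra.
Qed.

End Extremal.

Theorem theorem1 (R : realType) (n : nat) (hn : (1 <= n)%N) :
  (forall a : 'I_n -> R, normalized a ->
     exists m : R, is_min (zero_values a) m) /\
  isLub (@minima R n) (- tan (pi / (2 * n.+1%:R)) ^+ 2).
Proof.
split; first by move=> a _; apply: exists_min.
split; last by move=> b; apply: minima_lower_bound.
by move=> m [a [na am]]; apply: (min_upper_bound R n hn a).
Qed.
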